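(* Consider the traveling repairman problem with unit-time windows (defined in the context). Trim all windows using the periods $[j/2,(j+1)/2)$, $j\in\mathbb{Z}$ (offset $0$), and run the algorithm REPAIR on the trimmed instance with speed $3$. The resulting service run, which travels at speed $3$, has total profit at least $\frac{3}{4\gamma}\,\mathrm{profit}(R^* )$, where $R^*$ is a maximum-profit unit-speed service run for the original (untrimmed) windows. That is, this gives a $4\gamma/3$-approximation, and it runs in $\Gamma(n)$ time.
   Context: Problem: an undirected graph with metric edge lengths (either a tree or a general metric graph) on $n$ nodes, and $m$ service requests; request $i$ is located at a node $v_i$, has a nonnegative profit, and has a time window $[w_i,w_i+1)$ of unit length. A service run at speed $\sigma$ is a route that may start at any node at any time (unrooted) and moves so that it covers distance at most $\sigma t$ in any time interval of length $t$; it earns the profit of request $i$ (at most once) if it is at $v_i$ at some time in the window of request $i$. $R^*$ denotes a service run at speed $1$ of maximum total profit for the untrimmed windows. Trimming with offset $h$: the time line is divided into periods $[h+j/2,\,h+(j+1)/2)$, $j\in\mathbb{Z}$; assuming no window starts on a period boundary, each unit window contains exactly one period entirely, and the trimmed window of the request is that period. REPAIR is an algorithm which, given a trimmed instance and a speed $\sigma$, returns in time $\Gamma(n)$ a speed-$\sigma$ service run whose profit with respect to the trimmed windows is at least $1/\gamma$ times the maximum profit of any speed-$\sigma$ service run with respect to the trimmed windows; here $\gamma=1$ and $\Gamma(n)=O(n^4)$ when the graph is a tree, and $\gamma=2+\epsilon$ and $\Gamma(n)=O(n^{O(1/\epsilon^2)})$ for a general metric graph. An algorithm is a $\rho$-approximation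 if its output run has profit at least $\mathrm{profit}(R^* )/\rho$. *)

(* Defs.v *)
(* World: MathComp, over an arbitrary R : realType of MathComp-Analysis. *)
From HB Require Import structures.
From mathcomp Require Import all_boot all_order all_algebra.
From mathcomp Require Import boolp reals.
From mathcomp Require Import lra.

Set Implicit Arguments.
Unset Strict Implicit.
Unset Printing Implicit Defensive.

Import Order.TTheory GRing.Theory Num.Theory.
Local Open Scope ring_scope.

(** * Graphs, requests, windows *)

Fixpoint walk_length (R : realType) (T : Type) (len : T -> T -> R)
    (u : T) (p : seq T) : R :=
  if p is v :: p' then len u v + walk_length len v p' else 0.

(* The windows are kept apart from the rest of the data, because trimming
   changes only the windows.  [len u v] is meaningful only when [edge u v]. *)
Record network (R : realType) := Network {
  nnodes : nat;
  nreqs : nat;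
  edge : rel 'I_nnodes;
  len : 'I_nnodes -> 'I_nnodes -> R;
  loc : 'I_nreqs -> 'I_nnodes;
  gain : 'I_nreqs -> R;
  nnodes_gt0 : (0 < nnodes)%N;
  edge_sym : symmetric edge;
  edge_irr : irreflexive edge;
  len_sym : forall u v, len u v = len v u;
  len_gt0 : forall u v, edge u v -> 0 < len u v;
  len_metric : forall u p, path edge u p -> edge u (last u p) ->
    len u (last u p) <= walk_length len u p;
  gain_ge0 : forall i, 0 <= gain i
}.

Definition is_tree (R : realType) (A : network R) : Prop :=
  (forall u v, connect (@edge R A) u v) /\
  (forall c, ucycle (@edge R A) c -> (size c < 3)%N).

Inductive graph_class := Trees | MetricGraphs.

Definition in_class (R : realType) (c : graph_class) (A : network R) : Prop :=
  if c is Trees then is_tree A else True.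

Definition unit_window (R : realType) (w : R) : interval R := `[w, w + 1[.

(* Of length one half. *)
Definition half_window (R : realType) (p : R) : interval R := `[p, p + 2^-1[.

Definition period (R : realType) (h : R) (j : int) : interval R :=
  `[h + j%:~R / 2, h + (j + 1)%:~R / 2[.

Definition no_boundary_start (R : realType) (m : nat) (h : R)
    (w : 'I_m -> R) : Prop :=
  forall (i : 'I_m) (j : int), w i <> h + j%:~R / 2.

(* [p i] is the left end of the period that lies inside the unit window
   starting at [w i]; see [trimming_exists] and [trimming_unique]. *)
Definition trimming (R : realType) (m : nat) (h : R) (w p : 'I_m -> R) : Prop :=
  forall i, exists2 j : int, p i = h + j%:~R / 2 &
    {subset period h j <= unit_window (w i)}.

Definition trimmed_starts (R : realType) (m : nat) (p : 'I_m -> R) : Prop :=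
  exists h : R, forall i, exists j : int, p i = h + j%:~R / 2.

(** * Service runs *)

(* A route is the sequence of its stays [(v, a, d)]: it is at node [v] during
   the closed interval [[a, d]] (possibly [a = d], when it passes through),
   then crosses an edge to the next node, at constant speed, arriving there at
   the next [a]. *)
Definition stay (n : nat) (R : realType) : Type := 'I_n * R * R.
Definition node (n : nat) (R : realType) (x : stay n R) : 'I_n := x.1.1.
Definition arr (n : nat) (R : realType) (x : stay n R) : R := x.1.2.
Definition dep (n : nat) (R : realType) (x : stay n R) : R := x.2.

Definition crosses (R : realType) (A : network R) (sigma : R)
    (x y : stay (nnodes A) R) : bool :=
  [&& edge (node x) (node y), dep x <= arr y
    & len (node x) (node y) <= sigma * (arr y - dep x)].

Definition service_run (R : realType) (A : network R) (sigma : R)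
    (r : seq ('I_(nnodes A) * R * R)) : Prop :=
  [/\ r <> [::], all (fun x : stay (nnodes A) R => arr x <= dep x) r
    & sorted (@crosses R A sigma) r].

Definition at_node (n : nat) (R : realType) (r : seq ('I_n * R * R))
    (v : 'I_n) (t : R) : Prop :=
  exists x : 'I_n * R * R, [/\ x \in r, node x = v & arr x <= t <= dep x].

Definition profit (R : realType) (A : network R)
    (win : 'I_(nreqs A) -> interval R) (r : seq ('I_(nnodes A) * R * R)) : R :=
  \sum_(i < nreqs A | `[< exists2 t, at_node r (loc i) t & t \in win i >]) gain i.

Definition optimal_run (R : realType) (A : network R)
    (win : 'I_(nreqs A) -> interval R) (sigma : R)
    (r : seq ('I_(nnodes A) * R * R)) : Prop :=
  service_run sigma r /\
  forall q, service_run sigma q -> profit win q <= profit win r.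

(** * Algorithms: programs of a unit-cost real RAM *)

(* The memory has cells holding naturals and cells holding reals, both
   indirectly addressable through expressions over naturals.  Division by zero
   returns 0. *)
Inductive nexp :=
| NConst of nat
| NCell of nexp
| NAdd of nexp & nexp
| NSub of nexp & nexp
| NMul of nexp & nexp
| NDiv of nexp & nexp.

Inductive rexp :=
| RConst of int
| RNat of nexp
| RCell of nexp
| RAdd of rexp & rexp
| RSub of rexp & rexp
| RMul of rexp & rexp
| RDiv of rexp & rexp
| RFloor of rexp.

Inductive bexp :=
| BLeN of nexp & nexp
| BLeR of rexp & rexp
| BNot of bexp
| BAnd of bexp & bexp.

(* The first argument of an assignment or of an input instruction is the
   address of the cell that is written. *)
Inductive program :=
| Skip
| SetN of nexp & nexp
| SetR of nexp & rexp
| GetEdge of nexp & nexp & nexp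
| GetLen of nexp & nexp & nexp
| GetLoc of nexp & nexp
| GetGain of nexp & nexp
| GetStart of nexp & nexp
| Seq of program & program
| If of bexp & program & program
| While of bexp & program.

Record memory (R : realType) := Memory {
  ncell : nat -> nat;
  rcell : nat -> R
}.

Definition setn (R : realType) (s : memory R) (a x : nat) : memory R :=
  Memory (fun k => if k == a then x else ncell s k) (rcell s).

Definition setr (R : realType) (s : memory R) (a : nat) (x : R) : memory R :=
  Memory (ncell s) (fun k => if k == a then x else rcell s k).

Fixpoint neval (R : realType) (s : memory R) (e : nexp) : nat :=
  match e with
  | NConst k => k
  | NCell a => ncell s (neval s a)
  | NAdd e1 e2 => neval s e1 + neval s e2
  | NSub e1 e2 => neval s e1 - neval s e2
  | NMul e1 e2 => neval s e1 * neval s e2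
  | NDiv e1 e2 => neval s e1 %/ neval s e2
  end%N.

Fixpoint reval (R : realType) (s : memory R) (e : rexp) : R :=
  match e with
  | RConst z => z%:~R
  | RNat e1 => (neval s e1)%:R
  | RCell a => rcell s (neval s a)
  | RAdd e1 e2 => reval s e1 + reval s e2
  | RSub e1 e2 => reval s e1 - reval s e2
  | RMul e1 e2 => reval s e1 * reval s e2
  | RDiv e1 e2 => reval s e1 / reval s e2
  | RFloor e1 => (Num.floor (reval s e1))%:~R
  end.

Fixpoint beval (R : realType) (s : memory R) (b : bexp) : bool :=
  match b with
  | BLeN e1 e2 => (neval s e1 <= neval s e2)%N
  | BLeR e1 e2 => reval s e1 <= reval s e2
  | BNot b1 => ~~ beval s b1
  | BAnd b1 b2 => beval s b1 && beval s b2
  end.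

Fixpoint ncost (e : nexp) : nat :=
  match e with
  | NConst _ => 1
  | NCell a => (ncost a).+1
  | NAdd e1 e2 | NSub e1 e2 | NMul e1 e2 | NDiv e1 e2 =>
      (ncost e1 + ncost e2).+1
  end%N.

Fixpoint rcost (e : rexp) : nat :=
  match e with
  | RConst _ => 1
  | RNat e1 | RCell e1 => (ncost e1).+1
  | RAdd e1 e2 | RSub e1 e2 | RMul e1 e2 | RDiv e1 e2 =>
      (rcost e1 + rcost e2).+1
  | RFloor e1 => (rcost e1).+1
  end%N.

Fixpoint bcost (b : bexp) : nat :=
  match b with
  | BLeN e1 e2 => (ncost e1 + ncost e2).+1
  | BLeR e1 e2 => (rcost e1 + rcost e2).+1
  | BNot b1 => (bcost b1).+1
  | BAnd b1 b2 => (bcost b1 + bcost b2).+1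
  end%N.

(* [exec A w P s s' t]: on the input [A] with window starts [w], the program
   [P] leads from memory [s] to memory [s'] in [t] steps.  Reading the input
   out of range blocks. *)
Inductive exec (R : realType) (A : network R) (w : 'I_(nreqs A) -> R) :
    program -> memory R -> memory R -> nat -> Prop :=
| ExecSkip s : exec w Skip s s 1
| ExecSetN s a e :
    exec w (SetN a e) s (setn s (neval s a) (neval s e))
      (ncost a + ncost e).+1
| ExecSetR s a e :
    exec w (SetR a e) s (setr s (neval s a) (reval s e))
      (ncost a + rcost e).+1
| ExecGetEdge s a e1 e2 (u v : 'I_(nnodes A)) :
    neval s e1 = u -> neval s e2 = v ->
    exec w (GetEdge a e1 e2) s (setn s (neval s a) (edge u v))
      (ncost a + (ncost e1 + ncost e2)).+1
| ExecGetLen s a e1 e2 (u v : 'I_(nnodes A)) :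
    neval s e1 = u -> neval s e2 = v ->
    exec w (GetLen a e1 e2) s (setr s (neval s a) (len u v))
      (ncost a + (ncost e1 + ncost e2)).+1
| ExecGetLoc s a e (i : 'I_(nreqs A)) :
    neval s e = i ->
    exec w (GetLoc a e) s (setn s (neval s a) (loc i)) (ncost a + ncost e).+1
| ExecGetGain s a e (i : 'I_(nreqs A)) :
    neval s e = i ->
    exec w (GetGain a e) s (setr s (neval s a) (gain i)) (ncost a + ncost e).+1
| ExecGetStart s a e (i : 'I_(nreqs A)) :
    neval s e = i ->
    exec w (GetStart a e) s (setr s (neval s a) (w i)) (ncost a + ncost e).+1
| ExecSeq P1 P2 s s1 s2 t1 t2 :
    exec w P1 s s1 t1 -> exec w P2 s1 s2 t2 ->
    exec w (Seq P1 P2) s s2 (t1 + t2)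
| ExecIfT b P1 P2 s s' t :
    beval s b -> exec w P1 s s' t -> exec w (If b P1 P2) s s' (bcost b + t)
| ExecIfF b P1 P2 s s' t :
    ~~ beval s b -> exec w P2 s s' t -> exec w (If b P1 P2) s s' (bcost b + t)
| ExecWhileF b P s :
    ~~ beval s b -> exec w (While b P) s s (bcost b)
| ExecWhileT b P s s1 s2 t1 t2 :
    beval s b -> exec w P s s1 t1 -> exec w (While b P) s1 s2 t2 ->
    exec w (While b P) s s2 (bcost b + t1 + t2).

Definition init_memory (R : realType) (A : network R) (sigma : R) : memory R :=
  Memory (fun k => if k == 0 then nnodes A else if k == 1 then nreqs A else 0)%N
    (fun k => if k == 0%N then sigma else 0).

Definition encodes (R : realType) (n : nat) (s : memory R)
    (r : seq ('I_n * R * R)) : Prop :=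
  ncell s 0 = size r /\
  forall k x, onth r k = Some x ->
    [/\ ncell s k.+1 = node x, rcell s k.*2 = arr x & rcell s k.*2.+1 = dep x].

(* Execution being deterministic, there is at most one such [r] and [t]. *)
Definition outputs (R : realType) (A : network R) (w : 'I_(nreqs A) -> R)
    (sigma : R) (P : program) (r : seq ('I_(nnodes A) * R * R)) (t : nat) :
    Prop :=
  exists2 s, exec w P (init_memory A sigma) s t & encodes s r.

(* [P] gets half-open windows of length one half, through their left ends, and
   the speed.  Every window must be inspected, so that no bound on the number
   of steps can depend on the number of nodes alone: [Gamma] also takes the
   number of requests. *)
Definition repair_algorithm (R : realType) (c : graph_class) (gamma : R)
    (Gamma : nat -> nat -> nat) (P : program) : Prop :=
  forall (A : network R) (p : 'I_(nreqs A) -> R) (sigma : R),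
    in_class c A -> trimmed_starts p -> 0 < sigma ->
    exists r t, [/\ outputs p sigma P r t,
      (t <= Gamma (nnodes A) (nreqs A))%N,
      service_run sigma r
      & forall q, optimal_run (fun i => half_window (p i)) sigma q ->
          profit (fun i => half_window (p i)) q / gamma
            <= profit (fun i => half_window (p i)) r].

(** * Trimming with offset 0, then REPAIR at speed 3 *)

(* For [w] not in [Z/2], the period inside [[w, w+1)] starts at
   [(floor (2 w) + 1) / 2].  Windows are trimmed when they are read. *)
Definition trim_cell (a : nexp) : rexp :=
  RDiv (RAdd (RFloor (RMul (RConst 2) (RCell a))) (RConst 1)) (RConst 2).

Fixpoint trim_windows (P : program) : program :=
  match P with
  | GetStart a e => Seq (GetStart a e) (SetR a (trim_cell a))
  | Seq P1 P2 => Seq (trim_windows P1) (trim_windows P2)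
  | If b P1 P2 => If b (trim_windows P1) (trim_windows P2)
  | While b P1 => While b (trim_windows P1)
  | _ => P
  end.

(* A program finds its speed in real cell 0, here overwritten by 3. *)
Definition trim_and_repair3 (P : program) : program :=
  Seq (SetR (NConst 0) (RConst 3)) (trim_windows P).

(** * A window contains exactly one period *)

Lemma period_sub_unit (R : realType) (h w : R) (j : int) :
  {subset period h j <= unit_window w} <->
  w <= h + j%:~R / 2 <= w + 2^-1.
Proof.
rewrite /period /unit_window intrD; split=> [sub|/andP[h1 h2] t].
  have hj : h + j%:~R / 2 \in `[w, w + 1[.
    by apply: sub; rewrite in_itv /=; apply/andP; split; lra.
  move: hj; rewrite in_itv /= => /andP[-> lt1] /=.
  rewrite leNgt; apply/negP => gt2.
  have : w + 1 \in `[w, w + 1[.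
    by apply: sub; rewrite in_itv /=; apply/andP; split; lra.
  by rewrite in_itv /= ltxx andbF.
by rewrite !in_itv /= => /andP[? ?]; apply/andP; split; lra.
Qed.

Lemma trimming_exists (R : realType) (m : nat) (h : R) (w : 'I_m -> R) :
  no_boundary_start h w -> exists p, trimming h w p.
Proof.
move=> nb; pose j i := Num.floor (2 * (w i - h)) + 1.
exists (fun i => h + (j i)%:~R / 2) => i; exists (j i) => //.
apply/period_sub_unit; rewrite /j.
have h1 := floor_le (2 * (w i - h)); have h2 := floorD1_gt (2 * (w i - h)).
by apply/andP; move: h1 h2; rewrite intrD; split; lra.
Qed.

Lemma trimming_unique (R : realType) (m : nat) (h : R) (w p q : 'I_m -> R) :
  no_boundary_start h w -> trimming h w p -> trimming h w q -> p =1 q.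
Proof.
move=> nb tp tq i.
have [j -> /period_sub_unit hj] := tp i.
have [k -> /period_sub_unit hk] := tq i.
have lt (a b : int) : w i <= h + a%:~R / 2 <= w i + 2^-1 ->
    w i <= h + b%:~R / 2 <= w i + 2^-1 -> a <= b.
  move=> /andP[a1 a2] /andP[b1 b2].
  have nbb := nb i b; rewrite -ltzD1 -(ltr_int R) intrD.
  have {}b1 : w i < h + b%:~R / 2 by rewrite lt_neqAle b1 andbT; apply/eqP.
  lra.
by have -> : j = k by apply/le_anti; rewrite !lt.
Qed.

(* Main.v *)
(* With offset 0, the request that R* serves at time s has a trimmed window
   [p, p + 1/2) with p - 1/2 < s < p + 1.  Let phi be a zigzag of slopes 3 and
   -3, going forward for 2/3 of each time unit and backward for 1/3, and follow
   R* reparametrized by phi: this is a run at speed 3, and it serves the request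
   in its trimmed window if phi t = s for some t in that window.  Among the four
   phases of phi used here (shifts by 0 and 1/3, plus 0 or 1/2), for every
   request two sweep the whole of (p - 1/2, p + 1) forward during
   [p, p + 1/2), and one of the other two takes the value s, since one covers
   (p - 1/2, p + 1/2] and the other (p, p + 1).  Hence the four runs collect
   together at least three times the profit of R*, and the best one at least
   3/4 of it. *)
Require Import Defs.
From mathcomp Require Import all_boot all_order all_algebra.
From mathcomp Require Import boolp reals.
From mathcomp Require Import zify ring lra.

Set Implicit Arguments.
Unset Strict Implicit.
Unset Printing Implicit Defensive.

Import Order.TTheory GRing.Theory Num.Theory.
Local Open Scope ring_scope.

Section Walks.
Context {R : realType} {A : network R}.
Implicit Types (u v : 'I_(nnodes A)) (D : R) (r : seq ('I_(nnodes A) * R * R)).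

Definition travel u v D :=
  exists q, [/\ path (@edge R A) u q, last u q = v
    & walk_length (@len R A) u q <= D].

Lemma travel_refl u D : 0 <= D -> travel u u D.
Proof. by move=> D0; exists [::]. Qed.

Lemma travel_edge u v D : edge u v -> len u v <= D -> travel u v D.
Proof. by move=> uv D0; exists [:: v]; rewrite /= uv addr0. Qed.

Lemma travel_le u v D E : D <= E -> travel u v D -> travel u v E.
Proof.
by move=> DE [q [qe ql qD]]; exists q; split=> //; apply: le_trans DE.
Qed.

Lemma walk_length_cat (len : 'I_(nnodes A) -> 'I_(nnodes A) -> R) u q1 q2 :
  walk_length len u (q1 ++ q2) =
    walk_length len u q1 + walk_length len (last u q1) q2.
Proof. by elim: q1 u => [|x q1 IH] u /=; rewrite ?add0r // IH addrA. Qed.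

Lemma travel_trans u v x D E :
  travel u v D -> travel v x E -> travel u x (D + E).
Proof.
move=> [q1 [e1 <- d1]] [q2 [e2 <- d2]]; exists (q1 ++ q2).
by rewrite cat_path e1 e2 last_cat walk_length_cat lerD.
Qed.

Lemma travel_sym u v D : travel u v D -> travel v u D.
Proof.
case=> q; elim: q u D => [|x q IH] u D [/=].
  by move=> _ <- D0; apply: travel_refl.
move=> /andP[ux xq] qv qD.
have xv : travel v x (D - len u x) by apply: IH; split=> //; lra.
rewrite -(subrK (len u x) D); apply: travel_trans xv _.
by apply: travel_edge; rewrite 1?edge_sym 1?len_sym.
Qed.

Lemma walk_length_ge0 u q :
  path (@edge R A) u q -> 0 <= walk_length (@len R A) u q.
Proof.
elim: q u => //= x q IH u /andP[ux xq].
by rewrite addr_ge0 ?IH // ltW // len_gt0.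
Qed.

Lemma crosses_path_travel (sigma : R) x l : 0 <= sigma ->
  all (fun y : stay (nnodes A) R => arr y <= dep y) l ->
  path (@crosses R A sigma) x l ->
  forall y, y \in l -> travel (node x) (node y) (sigma * (arr y - dep x)).
Proof.
move=> s0; elim: l x => //= z l IH x /andP[z_ok l_ok] /andP[xz zl] y.
have [xze _ xzl] := and3P xz.
have tr_xz := travel_edge xze xzl.
rewrite inE => /predU1P[->//|yl].
apply: travel_le (travel_trans tr_xz (IH z l_ok zl y yl)).
rewrite -mulrDr ler_wpM2l //; lra.
Qed.

Lemma service_run_travel (sigma : R) r u v s t : 0 <= sigma ->
  service_run sigma r -> at_node r u s -> at_node r v t ->
  travel u v (sigma * `|s - t|).
Proof.
move=> s0 [_ r_ok r_sorted] [x [xr <- xs]] [y [yr <- yt]].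
elim: r r_ok r_sorted xr yr => //= z l IH /andP[z_ok l_ok] zl.
have from_z y' t' s' : y' \in l -> arr y' <= t' <= dep y' ->
    arr z <= s' <= dep z -> travel (node z) (node y') (sigma * `|s' - t'|).
  move=> y'l /andP[yt1 _] /andP[_ zs2].
  apply: travel_le (crosses_path_travel s0 l_ok zl y'l).
  rewrite ler_wpM2l // distrC; apply: le_trans (ler_norm _); lra.
rewrite !inE => /predU1P[xz|xl] /predU1P[yz|yl].
- by rewrite xz yz; apply: travel_refl; rewrite mulr_ge0.
- by rewrite xz; apply: from_z; rewrite -?xz.
- by rewrite yz distrC; apply: travel_sym; apply: from_z; rewrite -?yz.
- by apply: IH => //; apply: path_sorted zl.
Qed.

Lemma service_run_extend (sigma : R) u a d r v t : 0 < sigma ->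
  service_run sigma ((u, a, d) :: r) -> t <= a ->
  travel v u (sigma * (a - t)) ->
  exists d' r', service_run sigma ((v, t, d') :: r') /\
    forall z tau, at_node ((u, a, d) :: r) z tau ->
                  at_node ((v, t, d') :: r') z tau.
Proof.
move=> s0 run ta [q]; elim: q v t ta => [|x q IH] v t ta [/=].
  case: run => _ /= /andP[/= ad r_ok] r_sorted _ -> _.
  rewrite /arr /dep /= in ad.
  exists d, r; split.
    split=> //=; first by rewrite r_ok andbT; apply: le_trans ta ad.
    by move: r_sorted; case: (r).
  move=> z tau [y []]; rewrite inE => /predU1P[->|yr] yz ytau.
    exists (u, t, d); rewrite mem_head; split=> //.
    move: ytau => /andP[/= y1 y2]; apply/andP; split=> //.
    exact: le_trans y1.
  by exists y; rewrite inE yr orbT.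
move=> /andP[vx xq] qu qD; set t1 := t + len v x / sigma.
have lvx := len_gt0 vx; have wl := walk_length_ge0 xq.
have tt1 : t <= t1 by rewrite lerDl divr_ge0 // ltW.
have st1 : sigma * (t1 - t) = len v x.
  by rewrite /t1 addrC addKr mulrCA divff ?mulr1 // gt_eqF.
have sD : sigma * (a - t1) = sigma * (a - t) - len v x by rewrite -st1; ring.
have t1a : t1 <= a by rewrite -subr_ge0 -(pmulr_rge0 _ s0) sD; lra.
have [|d' [r' [[_ r'_ok r'_sorted] r'_at]]] := IH x t1 t1a.
  by split=> //; rewrite sD; lra.
exists t, ((x, t1, d') :: r'); split.
  split=> //; first by rewrite /= [X in X && _]lexx.
  apply/andP; split=> //; apply/and3P; split=> //.
  by rewrite [X in _ <= X]st1.
move=> z tau /r'_at[y [yr yz ytau]]; exists y; split=> //.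
by rewrite inE yr orbT.
Qed.

Lemma service_run1 (sigma : R) (v : 'I_(nnodes A)) t :
  service_run sigma [:: (v, t, t)].
Proof. by split=> //=; rewrite [X in X && _]lexx. Qed.

(* Routes cannot turn around inside an edge, so the reparametrized run is built
   from the finitely many visits that serve a request. *)
Lemma service_run_visiting (sigma : R) (l : seq ('I_(nnodes A) * R)) :
  0 < sigma ->
  (forall x y, x \in l -> y \in l -> travel x.1 y.1 (sigma * `|x.2 - y.2|)) ->
  exists2 r, service_run sigma r & forall x, x \in l -> at_node r x.1 x.2.
Proof.
move=> s0 close; pose before (x y : 'I_(nnodes A) * R) := x.2 <= y.2.
have bt : total before by move=> x y; apply: le_total.
have btr : transitive before by move=> y x z; apply: le_trans.
have := sort_sorted bt l; have : {subset sort before l <= l}.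
  by move=> x; rewrite mem_sort.
suff: forall l', {subset l' <= l} -> sorted before l' ->
    exists2 r, service_run sigma r & forall x, x \in l' -> at_node r x.1 x.2.
  move=> H sub srt; have [r run r_at] := H _ sub srt; exists r => // x xl.
  by apply: r_at; rewrite mem_sort.
case=> [_ _|x l' sub srt].
  by exists [:: (Ordinal (nnodes_gt0 A), 0, 0)] => //; apply: service_run1.
suff [d [r [run r_at]]] : exists d r, service_run sigma ((x.1, x.2, d) :: r) /\
    forall y, y \in x :: l' -> at_node ((x.1, x.2, d) :: r) y.1 y.2.
  by exists ((x.1, x.2, d) :: r).
elim: l' x sub srt => [|y l' IH] x sub /=.
  exists x.2, [::]; split; first exact: service_run1.
  move=> y; rewrite inE => /eqP ->; exists (x.1, x.2, x.2).
  by rewrite mem_head; split=> //; rewrite /arr /dep /= lexx.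
move=> /andP[xy yl'].
have [z zl|d [r [run r_at]]] := IH y _ yl'.
  by apply: sub; rewrite inE zl orbT.
have [||d' [r' [run' r'_at]]] :=
  @service_run_extend sigma y.1 y.2 d r x.1 x.2 s0 run.
- exact: xy.
- rewrite -[y.2 - x.2]ger0_norm ?subr_ge0 // distrC.
  by apply: close; apply: sub; rewrite !inE eqxx ?orbT.
exists d', r'; split=> // z; rewrite inE => /predU1P[->|zl].
  2: exact/r'_at/r_at.
case: run' => _ /= /andP[xd' _] _.
by exists (x.1, x.2, d'); rewrite mem_head; split=> //; rewrite /arr /= lexx.
Qed.

Lemma optimal_run_exists (win : 'I_(nreqs A) -> interval R) (sigma : R) :
  exists q, optimal_run win sigma q.
Proof.
pose served r : {set 'I_(nreqs A)} :=
  [set i | `[< exists2 t, at_node r (loc i) t & t \in win i >]].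
have profitE r : profit win r = \sum_(i in served r) gain i.
  by apply: eq_bigl => i; rewrite inE.
pose P B := `[< exists2 r, service_run sigma r & served r = B >].
have [B0 PB0] : exists B, P B.
  exists (served [:: (Ordinal (nnodes_gt0 A), 0, 0)]); apply/asboolP.
  by exists [:: (Ordinal (nnodes_gt0 A), 0, 0)]; first apply: service_run1.
pose F (B : {set 'I_(nreqs A)}) := \sum_(i in B) gain i.
have [B PB Bmax] := arg_maxP F PB0.
have [q run qB] := asboolW PB.
exists q; split=> // q' run'; rewrite !profitE qB; apply: Bmax.
by apply/asboolP; exists q'.
Qed.

Lemma reparametrized_run (win : 'I_(nreqs A) -> interval R) (sigma : R)
    (phi : R -> R) q : 0 < sigma ->
  (forall s t, `|phi s - phi t| <= sigma * `|s - t|) -> service_run 1 q ->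
  exists2 r, service_run sigma r &
    \sum_(i | `[< exists2 t, t \in win i & at_node q (loc i) (phi t) >]) gain i
      <= profit win r.
Proof.
move=> s0 lip q_run.
pose S := [set i | `[< exists2 t, t \in win i & at_node q (loc i) (phi t) >]].
have : forall i, exists t, i \in S -> t \in win i /\ at_node q (loc i) (phi t).
  move=> i; case: (boolP (i \in S)) => [|_]; last by exists 0.
  by rewrite inE => /asboolP[t t1 t2]; exists t.
move=> /choice[t t_ok].
have [|r run r_at] :=
    @service_run_visiting sigma [seq (loc i, t i) | i <- enum S] s0.
  move=> x y /mapP[i]; rewrite mem_enum => /t_ok[_ it] ->.
  move=> /mapP[j]; rewrite mem_enum => /t_ok[_ jt] -> /=.
  by apply: travel_le (service_run_travel ler01 q_run it jt); rewrite mul1r.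
exists r => //; rewrite /profit big_mkcond [leRHS]big_mkcond /=.
apply: ler_sum => i _; case: ifPn => [iS|_]; last first.
  by case: ifP => // _; apply: gain_ge0.
have {}iS : i \in S by rewrite inE.
rewrite ifT //; apply/asboolP; exists (t i); last by case: (t_ok i iS).
by apply: (r_at (loc i, t i)); apply: map_f; rewrite mem_enum.
Qed.

End Walks.

Section Zigzag.
Context {R : realType}.
Implicit Types (s t x y : R) (n : int).

(* Slope 3 on [[n, n + 2/3]] and slope -3 on [[n + 2/3, n + 1]], so that
   [zigzag n = n] for every integer [n]. *)
Definition zigzag t : R :=
  let n := (Num.floor t)%:~R in Num.min (3 * t - 2 * n) (4 * (n + 1) - 3 * t).

Lemma zigzag_lipschitz s t : `|zigzag s - zigzag t| <= 3 * `|s - t|.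
Proof.
wlog st : s t / s <= t.
  move=> H; case: (leP s t) => [/H//|/ltW/H].
  by rewrite distrC [in leRHS]distrC.
rewrite [in leRHS]distrC [in leRHS]ger0_norm ?subr_ge0 // /zigzag.
have hs := floor_itv s; have ht := floor_itv t.
have := le_floor st; rewrite le_eqVlt => /predU1P[fE|].
  rewrite fE in hs *; move: hs ht; rewrite !intrD.
  set n := _%:~R => /andP[? ?] /andP[? ?].
  by rewrite ler_norml !minEle; do !case: ifP => //; lra.
rewrite -lezD1 -(ler_int R); move: hs ht; rewrite !intrD.
set m := (Num.floor s)%:~R; set n := (Num.floor t)%:~R.
move=> /andP[? ?] /andP[? ?] ?.
by rewrite ler_norml !minElt; do !case: ltP => ?; lra.
Qed.

Lemma zigzagE n x : 0 <= x < 1 ->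
  zigzag (n%:~R + x) = n%:~R + Num.min (3 * x) (4 - 3 * x).
Proof.
move=> /andP[x0 x1]; rewrite /zigzag (floor_def (m := n)).
  by rewrite addr_minr; congr Num.min; ring.
by rewrite intrD; apply/andP; split; lra.
Qed.

Definition sweep (theta h t : R) : R := zigzag (t - theta - h) + h - 2^-1.

Lemma sweep_lipschitz theta h s t :
  `|sweep theta h s - sweep theta h t| <= 3 * `|s - t|.
Proof.
have -> : sweep theta h s - sweep theta h t =
    zigzag (s - theta - h) - zigzag (t - theta - h) by rewrite /sweep; ring.
apply: le_trans (zigzag_lipschitz _ _) _.
by rewrite (_ : _ - _ = s - t) //; ring.
Qed.

Lemma sweep_cover n (b : bool) (p s : R) : p = n%:~R + b%:R / 2 ->
  p - 2^-1 < s < p + 1 ->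
  let hit theta h := exists2 t, t \in half_window p & sweep theta h t = s in
  [/\ hit 0 (b%:R / 2), hit 3^-1 ((~~ b)%:R / 2)
    & hit 3^-1 (b%:R / 2) \/ hit 0 ((~~ b)%:R / 2)].
Proof.
move=> pE /andP[s1 s2].
have nb : (~~ b)%:R = 1 - b%:R :> R.
  by case: b {pE} => /=; rewrite ?subrr ?subr0.
have hitP theta h (m : int) x y : 0 <= y < 2^-1 -> 0 <= x < 1 ->
    p + y - theta - h = m%:~R + x ->
    s = m%:~R + Num.min (3 * x) (4 - 3 * x) + h - 2^-1 ->
    exists2 t, t \in half_window p & sweep theta h t = s.
  move=> /andP[y0 y1] x01 E ->; exists (p + y).
    by rewrite in_itv /=; apply/andP; split; lra.
  by rewrite /sweep E zigzagE.
split.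
- apply: (hitP _ _ n ((s - p + 2^-1) / 3) ((s - p + 2^-1) / 3)).
  + by apply/andP; split; lra.
  + by apply/andP; split; lra.
  + lra.
  + by rewrite minEle; case: leP => ?; lra.
- apply: (hitP _ _ (n + b%:Z - 1) ((s - p + 1) / 3) ((s - p + 2^-1) / 3)).
  + by apply/andP; split; lra.
  + by apply/andP; split; lra.
  + rewrite nb intrB intrD; lra.
  + by rewrite nb intrB intrD minEle; case: leP => ?; lra.
- have [sp|sp] := leP s (p + 2^-1).
    left; apply: (hitP _ _ (n - 1) ((p + 5 / 2 - s) / 3) ((p + 2^-1 - s) / 3)).
    + by apply/andP; split; lra.
    + by apply/andP; split; lra.
    + rewrite intrB; lra.
    + by rewrite intrB minEle; case: leP => ?; lra.
  right.
  apply: (hitP _ _ (n + b%:Z - 1) ((p + 3 - s) / 3) ((p + 3 / 2 - s) / 3)).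
  + by apply/andP; split; lra.
  + by apply/andP; split; lra.
  + rewrite nb intrB intrD; lra.
  + by rewrite nb intrB intrD minEle; case: leP => ?; lra.
Qed.

End Zigzag.

Section Trimming.
Context {R : realType} {A : network R}.
Implicit Types (w p : 'I_(nreqs A) -> R) (s : memory R).

Lemma trimming_itv w p i : no_boundary_start 0 w -> trimming 0 w p ->
  w i < p i < w i + 2^-1.
Proof.
move=> nb /(_ i)[j pE /period_sub_unit]; rewrite -pE => /andP[wp pw].
have nb0 := nb i j; have nb1 := nb i (j - 1).
rewrite !lt_neqAle wp pw !andbT; apply/andP; split; apply/eqP => E.
  by apply: nb0; rewrite E.
by apply: nb1; rewrite intrB; lra.
Qed.

Lemma trimmingE w p i : no_boundary_start 0 w -> trimming 0 w p ->
  ((Num.floor (2 * w i))%:~R + 1) / 2 = p i.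
Proof.
move=> nb tr; have /andP[wp pw] := trimming_itv i nb tr.
have [j pE _] := tr i; rewrite (floor_def (m := j - 1)) ?subrK.
  by rewrite intrB pE; lra.
by rewrite intrB; apply/andP; split; lra.
Qed.

Lemma neval_setr s a x e : neval (setr s a x) e = neval s e.
Proof.
by elim: e => //= [e ->|e1 -> e2 ->|e1 -> e2 ->|e1 -> e2 ->|e1 -> e2 ->].
Qed.

Lemma setr_setr s a x y : setr (setr s a x) a y = setr s a y.
Proof. by congr Memory; apply: funext => k /=; case: eqP. Qed.

Lemma exec_gt0 w P s s' t : exec w P s s' t -> (0 < t)%N.
Proof.
have bcost_gt0 b : (0 < bcost b)%N by case: b.
by elim=> // *; rewrite !addn_gt0 ?bcost_gt0 //; apply/orP; left.
Qed.

Lemma exec_trim w p P s s' t :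
  (forall i, ((Num.floor (2 * w i))%:~R + 1) / 2 = p i) ->
  exec p P s s' t ->
  exists2 t', exec w (trim_windows P) s s' t' & (t' <= 10 * t)%N.
Proof.
move=> trim; elim=> {P s s' t}.
- by move=> s; exists 1%N; first exact: ExecSkip.
- by move=> s a e; eexists; [exact: ExecSetN|exact: leq_pmull].
- by move=> s a e; eexists; [exact: ExecSetR|exact: leq_pmull].
- move=> s a e1 e2 u v h1 h2.
  by eexists; [exact: (ExecGetEdge _ _ h1 h2)|exact: leq_pmull].
- move=> s a e1 e2 u v h1 h2.
  by eexists; [exact: (ExecGetLen _ _ h1 h2)|exact: leq_pmull].
- by move=> s a e i h; eexists; [exact: (ExecGetLoc _ _ h)|exact: leq_pmull].
- by move=> s a e i h; eexists; [exact: (ExecGetGain _ _ h)|exact: leq_pmull].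
- move=> s a e i h; eexists.
    apply: ExecSeq; first exact: (ExecGetStart _ _ h).
    have -> : setr s (neval s a) (p i) =
        setr (setr s (neval s a) (w i)) (neval (setr s (neval s a) (w i)) a)
          (reval (setr s (neval s a) (w i)) (trim_cell a)).
      by rewrite neval_setr setr_setr /= neval_setr eqxx trim.
    exact: ExecSetR.
  rewrite /=; lia.
- move=> P1 P2 s s1 s2 t1 t2 _ [t1' e1 le1] _ [t2' e2 le2].
  by eexists; [exact: ExecSeq e1 e2|lia].
- move=> b P1 P2 s s' t sb _ [t' e le].
  by eexists; [exact: ExecIfT sb e|lia].
- move=> b P1 P2 s s' t sb _ [t' e le].
  by eexists; [exact: ExecIfF sb e|lia].
- by move=> b P s sb; eexists; [exact: ExecWhileF sb|exact: leq_pmull].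
- move=> b P s s1 s2 t1 t2 sb _ [t1' e1 le1] _ [t2' e2 le2].
  by eexists; [exact: ExecWhileT sb e1 e2|lia].
Qed.

Lemma outputs_trim_and_repair3 w p P r t :
  (forall i, ((Num.floor (2 * w i))%:~R + 1) / 2 = p i) ->
  outputs p 3 P r t ->
  exists2 t', outputs w 1 (trim_and_repair3 P) r t' & (t' <= 13 * t)%N.
Proof.
move=> trim [s ex enc]; have [t' ex' le] := exec_trim trim ex.
have init : init_memory A 3 =
    setr (init_memory A 1) (neval (init_memory A 1) (NConst 0))
      (reval (init_memory A 1) (RConst 3)).
  by congr Memory; apply: funext => k /=; case: eqP.
rewrite init in ex'; exists (3 + t')%N.
  by exists s => //; apply: ExecSeq ex'; apply: ExecSetR.
by have := exec_gt0 ex; lia.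
Qed.

Lemma profit_trimmed w p r : no_boundary_start 0 w -> trimming 0 w p ->
  profit (fun i => half_window (p i)) r <=
    profit (fun i => unit_window (w i)) r.
Proof.
move=> nb tr; rewrite /profit big_mkcond [leRHS]big_mkcond.
apply: ler_sum => i _; case: ifPn => [/asboolP[t rt tp]|_].
  rewrite ifT //; apply/asboolP; exists t => //.
  have /andP[wp pw] := trimming_itv i nb tr.
  by move: tp; rewrite !in_itv /= => /andP[? ?]; apply/andP; split; lra.
by case: ifP => // _; apply: gain_ge0.
Qed.

Lemma half_integer_parity (j : int) :
  exists (n : int) (b : bool), j%:~R / 2 = n%:~R + b%:R / 2 :> R.
Proof.
have [n [b ->]] : exists (n : int) (b : bool), j = n * 2 + b%:Z.
  exists (j %/ 2)%Z, (odd `|j|%N); lia.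
by exists n, b; rewrite intrD intrM; lra.
Qed.

Lemma le_three_quarters_profit w p q M :
  no_boundary_start 0 w -> trimming 0 w p ->
  service_run 1 q ->
  (forall r, service_run 3 r -> profit (fun i => half_window (p i)) r <= M) ->
  3 / 4 * profit (fun i => unit_window (w i)) q <= M.
Proof.
move=> nb tr q_run M_max.
pose hit theta h i :=
  `[< exists2 t, t \in half_window (p i) &
        at_node q (loc i) (sweep theta h t) >].
have le_M theta h : \sum_(i | hit theta h i) gain i <= M.
  have [r run le_r] := reparametrized_run (fun i => half_window (p i))
    (ltr0n R 3) (sweep_lipschitz theta h) q_run.
  by apply: le_trans le_r _; apply: M_max.
suff : 3 * profit (fun i => unit_window (w i)) q <=
    \sum_(i | hit 0 (false%:R / 2) i) gain i
    + \sum_(i | hit 0 (true%:R / 2) i) gain i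
    + (\sum_(i | hit 3^-1 (false%:R / 2) i) gain i
       + \sum_(i | hit 3^-1 (true%:R / 2) i) gain i).
  have := le_M 0 (false%:R / 2); have := le_M 0 (true%:R / 2).
  have := le_M 3^-1 (false%:R / 2); have := le_M 3^-1 (true%:R / 2).
  lra.
rewrite /profit mulr_sumr !(big_mkcond (hit _ _)) [leLHS]big_mkcond.
rewrite -!big_split /=.
apply: ler_sum => i _; have g0 := gain_ge0 i.
case: ifPn => [/asboolP[s q_at]|_]; last first.
  by do !case: ifP => _; rewrite ?addr0 ?add0r ?addr_ge0.
rewrite in_itv /= => /andP[ws sw]; have /andP[wp pw] := trimming_itv i nb tr.
have [j pE _] := tr i; rewrite add0r in pE.
have [n [b jE]] := half_integer_parity j; rewrite jE in pE.
have ps : p i - 2^-1 < s < p i + 1 by apply/andP; split; lra.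
have [full0 full1 half] := sweep_cover pE ps.
have hitI theta h :
    (exists2 t, t \in half_window (p i) & sweep theta h t = s) ->
    hit theta h i.
  by case=> t tp ts; apply/asboolP; exists t; rewrite ?ts.
move/hitI: full0 => full0; move/hitI: full1 => full1.
have {}half : hit 3^-1 (b%:R / 2) i || hit 0 ((~~ b)%:R / 2) i.
  by case: half => /hitI ->; rewrite ?orbT.
by case: b full0 full1 half {pE jE} => /= -> -> /orP[] ->; case: ifP => _; lra.
Qed.

End Trimming.

Theorem theorem2 (R : realType) (c : graph_class) (gamma : R)
    (Gamma : nat -> nat -> nat) (REPAIR : program)
    (gamma_ge1 : 1 <= gamma)
    (REPAIR_spec : repair_algorithm c gamma Gamma REPAIR) :
  exists K : nat,
  forall (A : network R) (w p : 'I_(nreqs A) -> R),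
    in_class c A -> no_boundary_start 0 w -> trimming 0 w p ->
    exists (r : seq ('I_(nnodes A) * R * R)) (t t' : nat),
      [/\ outputs p 3 REPAIR r t,
          outputs w 1 (trim_and_repair3 REPAIR) r t',
          (t' <= K * Gamma (nnodes A) (nreqs A))%N,
          service_run 3 r
        & forall Rstar : seq ('I_(nnodes A) * R * R),
            optimal_run (fun i => unit_window (w i)) 1 Rstar ->
            3 / (4 * gamma) * profit (fun i => unit_window (w i)) Rstar
              <= profit (fun i => unit_window (w i)) r].
Proof.
exists 13%N => A w p Ac nb tr.
have starts : trimmed_starts p.
  by exists 0 => i; have [j pE _] := tr i; exists j.
have [r [t [out tG run r_opt]]] := REPAIR_spec A p 3 Ac starts (ltr0n R 3).
have [t' out' t't] :=
  outputs_trim_and_repair3 (fun i => trimmingE i nb tr) out.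
exists r, t, t'; split=> //.
  by apply: leq_trans t't _; rewrite leq_mul2l tG orbT.
move=> Rstar [Rstar_run _]; apply: le_trans (profit_trimmed r nb tr).
have [q q_opt] := optimal_run_exists (fun i => half_window (p i)) 3.
apply: le_trans (r_opt q q_opt).
rewrite ler_pdivlMr ?(lt_le_trans ltr01) // mulrAC invfM mulrA mulfVK.
  by apply: le_three_quarters_profit nb tr Rstar_run _; case: q_opt.
by rewrite gt_eqF // (lt_le_trans ltr01).
Qed.
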